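(* Let $n,d\ge1$ be integers and let $\mathbb{Q}\mathcal{Y}_n^{(d)}$ be the $\mathbb{Q}$-vector space with basis the set $\mathcal{Y}_n^{(d)}$ of Young diagrams with at most $n$ rows, each row having at most $d$ boxes. The triple of linear operators $(\widetilde D_-,\widetilde D_0,\widetilde D_+)$ on $\mathbb{Q}\mathcal{Y}_n^{(d)}$, which acts on $\lambda\in\mathcal{Y}_n^{(d)}$ by $$\widetilde D_-(\lambda)=-\big(n\,\xi_-(\lambda)+\nabla_-(\lambda)\big),\qquad \widetilde D_0(\lambda)=(2|\lambda|-nd)\,\lambda,\qquad \widetilde D_+(\lambda)=\nabla_+(\lambda)-(n)\cdot\lambda,$$ where $(n)$ denotes the Young diagram consisting of a single row of $n$ boxes and $\cdot$ is the product of diagrams given by the Littlewood–Richardson coefficients, defines a finite-dimensional representation of $\mathfrak{sl}_2$ on $\mathbb{Q}\mathcal{Y}_n^{(d)}$.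
   Context: Let $\mathcal{Y}_n$ be the set of Young diagrams with at most $n$ rows (partitions with at most $n$ nonzero parts) and $\mathbb{Q}\mathcal{Y}_n$ the $\mathbb{Q}$-vector space with basis $\mathcal{Y}_n$; $\mathbb{Q}\mathcal{Y}_n^{(d)}$ is a subspace of it. $|\lambda|$ is the number of cells of $\lambda$, and the content of a cell in row $i$, column $j$ is $c(i,j)=j-i$. The operators $\xi_-,\nabla_\pm$ are defined on $\lambda\in\mathcal{Y}_n$ by $$\xi_-(\lambda)=\sum_{\mu=\lambda-b\in\mathcal{Y}_n}\mu,\qquad \nabla_\pm(\lambda)=\sum_{\mu=\lambda\pm b\in\mathcal{Y}_n}c(b)\,\mu,$$ where the sums run over all $\mu\in\mathcal{Y}_n$ obtained from $\lambda$ by removing (for $-$) or adding (for $+$) exactly one cell $b$. The space $\mathbb{Q}\mathcal{Y}_n$ is a commutative associative algebra under $\lambda\cdot\mu=\sum_{\nu\in\mathcal{Y}_n}c^\nu_{\lambda,\mu}\,\nu$, where $c^\nu_{\lambda,\mu}$ are the Littlewood–Richardson coefficients; it is isomorphic to the algebra of symmetric polynomials in $n$ variables over $\mathbb{Q}$ by sending each $\lambda$ to the Schur polynomial of $\lambda$. The Lie algebra $\mathfrak{sl}_2$ has basis $\mathfrak{e}_-,\mathfrak{h},\mathfrak{e}_+$ with $[\mathfrak{h},\mathfrak{e}_+]=2\mathfrak{e}_+$, $[\mathfrak{h},\mathfrak{e}_-]=-2\mathfrak{e}_-$, $[\mathfrak{e}_+,\mathfrak{e}_-]=\mathfrak{h}$;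 a representation of it in a vector space $V$ is a homomorphism $\mathfrak{sl}_2\to\mathrm{End}(V)$ preserving commutators, here given by $\mathfrak{e}_\pm\mapsto\widetilde D_\pm$, $\mathfrak{h}\mapsto\widetilde D_0$.
   Formalization: The formal theorem uses D̃_+(λ) = ∇_+(λ) − d·(1)·λ, with d times the product by the one-box diagram, in place of (n)·λ; with (n)·λ the operator does not preserve the space unless n = d = 1, where the two formulas agree. *)

(* Defs.v *)
From HB Require Import structures.
From mathcomp Require Import all_boot all_order all_algebra.
From mathcomp Require Import monalg.

Set Implicit Arguments.
Unset Strict Implicit.
Unset Printing Implicit Defensive.

Import Order.TTheory GRing.Theory Num.Theory.
Local Open Scope ring_scope.

(* Rows, columns and tableau entries are numbered from 0.  Contents
   [j - i] do not depend on this, as both indices are shifted. *)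

Definition nonincreasing (n : nat) (f : 'I_n -> nat) : bool :=
  [forall i : 'I_n, forall j : 'I_n, (i <= j)%N ==> (f j <= f i)%N].

Record diagram (n : nat) := Diagram {
  rows : {ffun 'I_n -> nat};
  rows_noninc : nonincreasing rows
}.
HB.instance Definition _ n := [isSub for @rows n].
HB.instance Definition _ n := [Choice of diagram n by <:].

Definition row_len n (lam : diagram n) (i : 'I_n) : nat := rows lam i.
Coercion row_len : diagram >-> Funclass.

Definition ncells n (lam : diagram n) : nat := (\sum_(i < n) lam i)%N.

Definition content (i j : nat) : int := j%:Z - i%:Z.

(* The diagrams obtained from [lam] by adding, resp. removing, a cell at the
   end of row [i], i.e. the cell in column [lam i], resp. [(lam i).-1]; the
   value is [None] when the result is not a diagram. *)
Definition add_cell n (lam : diagram n) (i : 'I_n) : option (diagram n) :=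
  insub [ffun k => lam k + (k == i)]%N.

Definition remove_cell n (lam : diagram n) (i : 'I_n) : option (diagram n) :=
  if (0 < lam i)%N then insub [ffun k => lam k - (k == i)]%N else None.

Lemma single_row_noninc n (k : nat) :
  nonincreasing [ffun i : 'I_n => if val i == 0%N then k else 0%N].
Proof.
apply/forallP => i; apply/forallP => j; apply/implyP => le_ij.
rewrite !ffunE; case: eqP => // j0.
by move: le_ij; rewrite [nat_of_ord j]j0 leqn0 => ->.
Qed.

Definition single_row n (k : nat) : diagram n := Diagram (single_row_noninc n k).

Definition QY (n : nat) := {malg rat[diagram n]}.
HB.instance Definition _ n := GRing.Lmodule.on (QY n).

Definition dvec n (lam : diagram n) : QY n := mkmalgU lam 1.

Definition dvec_opt n (o : option (diagram n)) : QY n :=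
  if o is Some mu then dvec mu else 0.

Definition xi_minus n (lam : diagram n) : QY n :=
  \sum_(i < n) dvec_opt (remove_cell lam i).

Definition nabla_minus n (lam : diagram n) : QY n :=
  \sum_(i < n) (content i (lam i).-1)%:~R *: dvec_opt (remove_cell lam i).

Definition nabla_plus n (lam : diagram n) : QY n :=
  \sum_(i < n) (content i (lam i))%:~R *: dvec_opt (add_cell lam i).

Record box_diagram (n d : nat) := BoxDiagram {
  box_rows : {ffun 'I_n -> 'I_d.+1};
  box_rows_noninc : nonincreasing (fun i => box_rows i)
}.
HB.instance Definition _ n d := [isSub for @box_rows n d].
HB.instance Definition _ n d := [Finite of box_diagram n d by <:].

Lemma diagram_of_box_noninc n d (lam : box_diagram n d) :
  nonincreasing [ffun i => nat_of_ord (box_rows lam i)].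
Proof.
apply/forallP => i; apply/forallP => j; rewrite !ffunE.
by have /forallP/(_ i)/forallP/(_ j) := box_rows_noninc lam.
Qed.

Definition diagram_of_box n d (lam : box_diagram n d) : diagram n :=
  Diagram (diagram_of_box_noninc lam).
Coercion diagram_of_box : box_diagram >-> diagram.

Definition skew_cell n (lam nu : diagram n) :=
  {c : 'I_n * 'I_(ncells nu) | (lam c.1 <= c.2 < nu c.1)%N}.
HB.instance Definition _ n (lam nu : diagram n) :=
  Finite.on (skew_cell lam nu).

Section LittlewoodRichardson.
Context (n : nat) (lam nu : diagram n).

Definition cell_row (c : skew_cell lam nu) : nat := (val c).1.
Definition cell_col (c : skew_cell lam nu) : nat := (val c).2.

Definition semistandard (T : {ffun skew_cell lam nu -> 'I_n}) : bool :=
  [forall c, forall c',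
     (((cell_row c == cell_row c') && (cell_col c <= cell_col c')%N)
        ==> (T c <= T c')%N)
  && (((cell_col c == cell_col c') && (cell_row c < cell_row c')%N)
        ==> (T c < T c')%N)].

Definition has_weight (mu : diagram n) (T : {ffun skew_cell lam nu -> 'I_n}) :=
  [forall v : 'I_n, #|[set c | T c == v]| == mu v].

(* [c] is read no later than [c'] when rows are read from top to bottom, each
   of them from right to left. *)
Definition read_upto (c' c : skew_cell lam nu) : bool :=
  (cell_row c < cell_row c')%N
  || ((cell_row c == cell_row c') && (cell_col c' <= cell_col c)%N).

Definition lattice_word (T : {ffun skew_cell lam nu -> 'I_n}) : bool :=
  [forall c', forall u : 'I_n, forall v : 'I_n, (v == u.+1 :> nat) ==>
    (#|[set c | read_upto c' c && (T c == v)]|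
       <= #|[set c | read_upto c' c && (T c == u)]|)%N].

End LittlewoodRichardson.

(* The number of Littlewood-Richardson tableaux of shape [nu / lam] and weight
   [mu]; as [mu] has at most [n] rows, entries in ['I_n] suffice. *)
Definition LR_coef n (lam mu nu : diagram n) : nat :=
  if [forall i, (lam i <= nu i)%N]
  then #|[set T : {ffun skew_cell lam nu -> 'I_n} |
           [&& semistandard T, has_weight mu T & lattice_word T]]|
  else 0%N.

(* [LR_coef lam mu nu] vanishes unless [ncells nu = ncells lam + ncells mu], so
   that restricting the length of the rows of [nu] does not omit any term. *)
Definition LR_prod n (lam mu : diagram n) : QY n :=
  \sum_(nu : box_diagram n (ncells lam + ncells mu))
    (LR_coef lam mu nu)%:R *: dvec nu.

Definition Dtilde_minus n (lam : diagram n) : QY n :=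
  - (n%:R *: xi_minus lam + nabla_minus lam).

Definition Dtilde_zero n (d : nat) (lam : diagram n) : QY n :=
  ((2 * ncells lam)%:R - (n * d)%:R) *: dvec lam.

(* In terms of Schur polynomials this is multiplication by
   [- d (x_1 + ... + x_n)] added to the action of [\sum_i x_i^2 d/dx_i].
   If all rows of [lam] have length at most [d], a cell added in column [d]
   lies in row 0 and has content [d], so that the terms leaving the box cancel:
   this fixes the factor [d]. *)
Definition Dtilde_plus n (d : nat) (lam : diagram n) : QY n :=
  nabla_plus lam - d%:R *: LR_prod (single_row n 1) lam.

Definition QYbox (n d : nat) := {ffun box_diagram n d -> rat^o}.
HB.instance Definition _ n d := Vector.on (QYbox n d).

Definition box_vec n d (lam : box_diagram n d) : QYbox n d :=
  [ffun mu => (mu == lam)%:R].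

Definition QYbox_incl n d (v : QYbox n d) : QY n :=
  \sum_(lam : box_diagram n d) v lam *: dvec lam.

(* Coordinates 0, 1, 2 are those along [sl2_em], [sl2_h], [sl2_ep]. *)
Definition sl2 := 'rV[rat]_3.
HB.instance Definition _ := Vector.on sl2.

Definition sl2_em : sl2 := delta_mx 0 (inord 0).
Definition sl2_h : sl2 := delta_mx 0 (inord 1).
Definition sl2_ep : sl2 := delta_mx 0 (inord 2).

Definition sl2_bracket (x y : sl2) : sl2 :=
  let xm := x 0 (inord 0) in let xh := x 0 (inord 1) in
  let xp := x 0 (inord 2) in
  let ym := y 0 (inord 0) in let yh := y 0 (inord 1) in
  let yp := y 0 (inord 2) in
  (2 * (xm * yh - xh * ym)) *: sl2_em
  + (xp * ym - xm * yp) *: sl2_h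
  + (2 * (xh * yp - xp * yh)) *: sl2_ep.

Definition sl2_coord :=
  (mxE, eqxx, andTb, mulr1, mul1r, mulr0, mul0r, subr0, sub0r, scale0r,
   addr0, add0r, mulrN1, scale1r).

Lemma sl2_coord_neq :
  ((inord 0 == inord 1 :> 'I_3) = false) * ((inord 0 == inord 2 :> 'I_3) = false)
  * ((inord 1 == inord 0 :> 'I_3) = false) * ((inord 1 == inord 2 :> 'I_3) = false)
  * ((inord 2 == inord 0 :> 'I_3) = false) * ((inord 2 == inord 1 :> 'I_3) = false).
Proof. by rewrite -!val_eqE /= !inordK. Qed.

Lemma sl2_bracket_h_ep : sl2_bracket sl2_h sl2_ep = 2 *: sl2_ep.
Proof. by rewrite /sl2_bracket !sl2_coord !sl2_coord_neq /= !sl2_coord. Qed.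

Lemma sl2_bracket_h_em : sl2_bracket sl2_h sl2_em = - 2 *: sl2_em.
Proof. by rewrite /sl2_bracket !sl2_coord !sl2_coord_neq /= !sl2_coord. Qed.

Lemma sl2_bracket_ep_em : sl2_bracket sl2_ep sl2_em = sl2_h.
Proof. by rewrite /sl2_bracket !sl2_coord !sl2_coord_neq /= !sl2_coord. Qed.

Lemma sl2_bracketxx x : sl2_bracket x x = 0.
Proof.
by rewrite /sl2_bracket ![x 0 (inord 0) * _]mulrC ![x 0 (inord 1) * _]mulrC
  !subrr !mulr0 !scale0r !addr0.
Qed.

Definition is_sl2_representation (V : vectType rat)
    (rho : 'Hom(sl2, 'End(V))) : Prop :=
  forall x y : sl2,
    rho (sl2_bracket x y) = (rho x \o rho y)%VF - (rho y \o rho x)%VF.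

(* Main.v *)
Require Import Defs.
From HB Require Import structures.
From mathcomp Require Import all_boot all_order all_algebra.
From mathcomp Require Import monalg zify ring.
Import Order.TTheory GRing.Theory Num.Theory.
Local Open Scope ring_scope.
Set Implicit Arguments.
Unset Strict Implicit.
Unset Printing Implicit Defensive.

(* The Littlewood-Richardson product with a single box is given by the Pieri
   rule, so with x_i = lam_i - i the raising operator adds a cell to row i with
   coefficient x_i - d and the lowering operator removes one with coefficient
   -(n + x_i - 1).  In [D+, D-] the terms moving a cell from row i to a row
   j <> i cancel.  With F(x) = (n + x)(x - d) the diagonal coefficient is the
   sum of F(x_i) over the rows where a cell can be added minus the sum of
   F(x_i - 1) over those where one can be removed.  Both sums may be extended to
   all rows: row i + 1 cannot be extended exactly when row i cannot be
   shortened, and then x_(i+1) = x_i - 1, while F(x_0) = F(d) = 0 if row 0 is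
   full and F(x_(n-1) - 1) = F(-n) = 0 if the last row is empty.  This leaves
   the sum of F(x_i) - F(x_i - 1) = 2 x_i - 1 + n - d, which is 2 |lam| - n d. *)

(** * The commutation relations *)

Lemma nonincreasingP n (f : 'I_n -> nat) :
  reflect (forall i j : 'I_n, (i <= j)%N -> (f j <= f i)%N) (nonincreasing f).
Proof.
apply: (iffP forallP) => [H i j|H i].
  by have /forallP/(_ j)/implyP := H i.
by apply/forallP => j; apply/implyP; apply: H.
Qed.

(** * Row sequences and the basis indexed by diagrams in the box *)

Section Rows.
Context (n d : nat).
Implicit Types (f : {ffun 'I_n -> nat}) (lam : box_diagram n d) (i j : 'I_n).

Definition box_rows_nat lam : {ffun 'I_n -> nat} := rows (diagram_of_box lam).

Definition in_box f : bool := nonincreasing f && [forall i, (f i <= d)%N].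

Definition incr_row f i : {ffun 'I_n -> nat} := [ffun k => f k + (k == i)]%N.
(** Subtraction is truncated, so an empty row stays as it is; hence the tests [0 < f i] in [lower]
    and [removable]. *)
Definition decr_row f i : {ffun 'I_n -> nat} := [ffun k => f k - (k == i)]%N.

Lemma in_boxP f :
  reflect (exists lam, box_rows_nat lam = f) (in_box f).
Proof.
apply: (iffP andP) => [[/nonincreasingP fN /forallP fd]|[lam <-]]; last first.
  split; first exact: rows_noninc.
  by apply/forallP => i; rewrite ffunE -ltnS.
have H : nonincreasing (fun i => [ffun i => inord (f i) : 'I_d.+1] i).
  apply/nonincreasingP => i j le_ij.
  by rewrite !ffunE !inordK ?ltnS ?fd // fN.
exists (BoxDiagram H); apply/ffunP => i.
by rewrite !ffunE /= inordK ?ltnS ?fd.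
Qed.

Lemma box_rows_nat_inj : injective box_rows_nat.
Proof.
move=> lam mu /ffunP eq_lm; apply: val_inj; apply/ffunP => i; apply: val_inj.
by have := eq_lm i; rewrite !ffunE.
Qed.

Lemma in_box_rows lam : in_box (box_rows_nat lam).
Proof. by apply/in_boxP; exists lam. Qed.

(* Zero when [f] is not the row sequence of a diagram inside the box. *)
Definition rvec f : QYbox n d := [ffun mu => (box_rows_nat mu == f)%:R].

Lemma rvec_rows lam : rvec (box_rows_nat lam) = box_vec lam.
Proof.
by apply/ffunP => mu; rewrite !ffunE (inj_eq box_rows_nat_inj).
Qed.

Lemma rvec_eq0 f : ~~ in_box f -> rvec f = 0.
Proof.
move=> fN; apply/ffunP => mu; rewrite !ffunE; case: eqP => // eq_f.
by case/in_boxP: fN; exists mu.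
Qed.

Definition extend (g : box_diagram n d -> QYbox n d) (v : QYbox n d) : QYbox n d :=
  \sum_lam v lam *: g lam.

Lemma extend_linear g : linear (extend g).
Proof.
move=> a u v; rewrite /extend scaler_sumr -big_split /=.
by apply: eq_bigr => lam _; rewrite !ffunE scalerDl scalerA.
Qed.
HB.instance Definition _ g :=
  GRing.isLinear.Build rat (QYbox n d) (QYbox n d) _ (extend g) (extend_linear g).

Lemma extend_box g lam : extend g (box_vec lam) = g lam.
Proof.
rewrite /extend (bigD1 lam) //= ffunE eqxx scale1r big1 ?addr0 // => mu.
by rewrite ffunE => /negPf->; rewrite scale0r.
Qed.

Lemma extend_rvec (g : {ffun 'I_n -> nat} -> QYbox n d) f :
  extend (g \o box_rows_nat) (rvec f) = if in_box f then g f else 0.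
Proof.
case: ifPn => [/in_boxP[lam <-]|/rvec_eq0->]; last exact: raddf0.
by rewrite rvec_rows extend_box.
Qed.

Lemma box_vec_sum (v : QYbox n d) : v = \sum_lam v lam *: box_vec lam.
Proof.
apply/ffunP => mu; rewrite sum_ffunE (bigD1 mu) //= !ffunE eqxx [_ *: _]mulr1.
by rewrite big1 ?addr0 // => lam; rewrite !ffunE eq_sym => /negPf->; exact: mulr0.
Qed.

Lemma endo_box_ext (A B : 'End(QYbox n d)) :
  (forall lam, A (box_vec lam) = B (box_vec lam)) -> A = B.
Proof.
move=> AB; apply/lfunP => v; rewrite [v]box_vec_sum !linear_sum.
by apply: eq_bigr => lam _; rewrite !linearZ /= AB.
Qed.

(** * The operators on row sequences and their relations with the weight *)

Definition upc f i : rat := (content i (f i))%:~R - d%:R.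
Definition downc f i : rat := - (n%:R + (content i (f i).-1)%:~R).

(** Terms leaving the box are dropped, as [rvec] is zero there; [QYbox_incl_raise] shows that this
    loses nothing. *)
Definition raise f : QYbox n d := \sum_i upc f i *: rvec (incr_row f i).
Definition lower f : QYbox n d :=
  \sum_i downc f i *: (if (0 < f i)%N then rvec (decr_row f i) else 0).
Definition weight f : QYbox n d := ((2 * \sum_i f i)%:R - (n * d)%:R) *: rvec f.

Definition op (g : {ffun 'I_n -> nat} -> QYbox n d) : 'End(QYbox n d) :=
  linfun (extend (g \o box_rows_nat)).

Lemma op_rvec g f : op g (rvec f) = if in_box f then g f else 0.
Proof. by rewrite lfunE /= extend_rvec. Qed.

Lemma op_box g lam : op g (box_vec lam) = g (box_rows_nat lam).
Proof. by rewrite -rvec_rows op_rvec in_box_rows. Qed.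

(** Outside the box both sides are zero, so the case distinction of [op_rvec] disappears. *)
Lemma op_weight_rvec f : op weight (rvec f) = weight f.
Proof.
rewrite op_rvec; case: ifPn => // /rvec_eq0 f0.
by rewrite /weight f0 scaler0.
Qed.

Lemma sum_incr_row f i : (\sum_k incr_row f i k = (\sum_k f k).+1)%N.
Proof.
under eq_bigr do rewrite ffunE.
rewrite big_split /= -addn1; congr addn.
by rewrite -big_mkcond /= big_pred1_eq.
Qed.

Lemma decr_rowK f i : (0 < f i)%N -> incr_row (decr_row f i) i = f.
Proof.
by move=> fi; apply/ffunP => k; rewrite !ffunE; case: eqP => [->|_]; rewrite ?subnK // addn0 subn0.
Qed.

Lemma incr_rowK f i : decr_row (incr_row f i) i = f.
Proof. by apply/ffunP => k; rewrite !ffunE addnK. Qed.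

(** Each term of [raise] has one cell more, so its weight is larger by 2. *)
Lemma op_weight_raise :
  (op weight \o op raise)%VF - (op raise \o op weight)%VF = 2 *: op raise.
Proof.
apply: endo_box_ext => lam; rewrite !(comp_lfunE, scale_lfunE, opp_lfunE, add_lfunE) !op_box.
rewrite /weight linearZ /= op_rvec in_box_rows.
rewrite /raise linear_sum !scaler_sumr -sumrB; apply: eq_bigr => i _.
rewrite linearZ /= op_weight_rvec /weight sum_incr_row !scalerA -scalerBl.
by congr (_ *: _); rewrite mulnS natrD; ring.
Qed.

Lemma op_weight_lower :
  (op weight \o op lower)%VF - (op lower \o op weight)%VF = - 2 *: op lower.
Proof.
apply: endo_box_ext => lam; rewrite !(comp_lfunE, scale_lfunE, opp_lfunE, add_lfunE) !op_box.
rewrite /weight linearZ /= op_rvec in_box_rows.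
rewrite /lower linear_sum !scaler_sumr -sumrB; apply: eq_bigr => i _.
rewrite linearZ /=; case: ifP => [fi|_]; last by rewrite linear0 !scaler0 subrr.
rewrite op_weight_rvec /weight !scalerA -scalerBl.
have -> : (\sum_k box_rows_nat lam k = (\sum_k decr_row (box_rows_nat lam) i k).+1)%N.
  by rewrite -(sum_incr_row _ i) decr_rowK.
by congr (_ *: _); rewrite mulnS natrD; ring.
Qed.

(** * The commutator of raising and lowering *)

Lemma decr_incr_rowC f i j : i != j ->
  incr_row (decr_row f i) j = decr_row (incr_row f j) i.
Proof.
move=> ij; apply/ffunP => k; rewrite !ffunE.
case: (eqVneq k i) => [->|]; last by lia.
by rewrite (negPf ij); lia.
Qed.

(* [decr_row f i] and [incr_row f j] are the pointwise minimum and maximum of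
   [f] and the sequence with the cell moved. *)
Lemma in_box_meet f i j : i != j -> in_box f -> (0 < f i)%N ->
  in_box (incr_row (decr_row f i) j) -> in_box (decr_row f i) && in_box (incr_row f j).
Proof.
move=> ij /andP[/nonincreasingP fN /forallP fd] fi.
case/andP=> /nonincreasingP gN /forallP gd.
apply/andP; split; apply/andP; split.
- apply/nonincreasingP => k l kl; have := fN _ _ kl; have := gN _ _ kl.
  rewrite !ffunE; case: (eqVneq k i) => [ki|]; last by lia.
  by rewrite ki (negPf ij); lia.
- by apply/forallP => k; rewrite ffunE (leq_trans (leq_subr _ _)).
- apply/nonincreasingP => k l kl; have := fN _ _ kl; have := gN _ _ kl.
  rewrite !ffunE; case: (eqVneq l j) => [lj|]; last by lia.
  by rewrite lj [j == i]eq_sym (negPf ij); lia.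
- apply/forallP => k; have := fd k; have := gd k; rewrite !ffunE.
  case: (eqVneq k j) => [kj|]; last by lia.
  by rewrite kj [j == i]eq_sym (negPf ij); lia.
Qed.

(** This is F of the outline, and [shifted f i] is x_i, the content of the first cell beyond row
    i. *)
Definition quad (x : rat) : rat := (n%:R + x) * (x - d%:R).

Definition shifted f i : rat := (f i)%:R - i%:R.
Definition removable f i : bool := (0 < f i)%N && in_box (decr_row f i).
Definition addable f i : bool := in_box (incr_row f i).

Lemma downc_shifted f i : (0 < f i)%N -> downc f i = - (n%:R + (shifted f i - 1)).
Proof.
move=> fi; rewrite /downc /content /shifted.
by rewrite -{2}(prednK fi) rmorphB /= -natr1 -!pmulrn; ring.
Qed.

Lemma upc_shifted f i : upc f i = shifted f i - d%:R.
Proof. by rewrite /upc /content /shifted rmorphB. Qed.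

(** A cell is removed from row i and one is added to row j, in both orders. For distinct rows the
    results and the coefficients agree; for i = j the sequence returns to [f]. *)
Lemma commutator_term f i j : in_box f ->
  (if removable f i then (downc f i * upc (decr_row f i) j) *:
     rvec (incr_row (decr_row f i) j) else 0)
  - (if addable f j then (upc f j * downc (incr_row f j) i) *:
     (if (0 < incr_row f j i)%N then rvec (decr_row (incr_row f j) i) else 0)
     else 0)
  = if i == j then
      ((if addable f i then quad (shifted f i) else 0)
       - (if removable f i then quad (shifted f i - 1) else 0)) *: rvec f
    else 0.
Proof.
move=> fB; case: (eqVneq i j) => [<-{j}|ij].
  rewrite /addable /removable incr_rowK ffunE eqxx addn1 /=.
  rewrite scalerBl addrC; congr (_ + _).
    case: ifP => _; last by rewrite scale0r oppr0.
    rewrite -scaleNr; congr (_ *: _).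
    rewrite downc_shifted ?ffunE ?eqxx ?addn1 // upc_shifted /quad.
    by rewrite /shifted ffunE eqxx addn1 -natr1; ring.
  case: ifP => [/andP[fi _]|_]; last by rewrite scale0r oppr0.
  rewrite decr_rowK // -scaleNr; congr (_ *: _).
  rewrite downc_shifted // upc_shifted /quad /shifted ffunE eqxx natrB //.
  by rewrite /=; ring.
have ji : (j == i) = false by rewrite eq_sym (negPf ij).
rewrite /removable /addable -decr_incr_rowC // [incr_row _ _ _]ffunE (negPf ij) addn0.
case: (posnP (f i)) => [fi0|fi] /=.
  by rewrite scaler0 if_same subr0.
have -> : upc (decr_row f i) j = upc f j.
  by rewrite /upc ffunE ji subn0.
have -> : downc (incr_row f j) i = downc f i.
  by rewrite /downc ffunE (negPf ij) addn0.
(* If the final sequence is in the box, [in_box_meet] puts both intermediate ones there too, and the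
   terms cancel; otherwise both are zero. *)
case: (boolP (in_box (incr_row (decr_row f i) j))) => [gB|/rvec_eq0->].
  by have /andP[-> ->] := in_box_meet ij fB fi gB; rewrite mulrC subrr.
by rewrite !scaler0 !if_same subrr.
Qed.

Lemma commutator_diag f : in_box f ->
  op raise (lower f) - op lower (raise f) =
  (\sum_i ((if addable f i then quad (shifted f i) else 0)
       - (if removable f i then quad (shifted f i - 1) else 0))) *: rvec f.
Proof.
move=> fB; rewrite [op raise (lower f)]linear_sum [op lower (raise f)]linear_sum /=.
(* Both compositions become double sums over the row i losing a cell and the row j gaining one. *)
transitivity (\sum_i \sum_j
  ((if removable f i then (downc f i * upc (decr_row f i) j) *:
     rvec (incr_row (decr_row f i) j) else 0)
  - (if addable f j then (upc f j * downc (incr_row f j) i) *: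
     (if (0 < incr_row f j i)%N then rvec (decr_row (incr_row f j) i) else 0)
     else 0))).
  under [RHS]eq_bigr do rewrite sumrB.
  rewrite sumrB; congr (_ - _).
    apply: eq_bigr => i _; rewrite linearZ /= /removable.
    case: ifP => fi /=; last by rewrite linear0 scaler0 big1.
    rewrite op_rvec; case: ifP => _; last by rewrite scaler0 big1.
    by rewrite scaler_sumr; apply: eq_bigr => j _; rewrite scalerA.
  rewrite exchange_big; apply: eq_bigr => j _; rewrite linearZ /= op_rvec /addable.
  case: ifP => _; last by rewrite scaler0 big1.
  by rewrite scaler_sumr; apply: eq_bigr => i _; rewrite scalerA.
rewrite scaler_suml; apply: eq_bigr => i _.
under eq_bigr do rewrite commutator_term //.
by rewrite -big_mkcond /= (big_pred1 i) // => j; rewrite eq_sym.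
Qed.

End Rows.

(** * Rows that can be lengthened or shortened, and the diagonal coefficient *)

Lemma addable0 n d (f : {ffun 'I_n.+1 -> nat}) : in_box d f ->
  addable d f ord0 = (f ord0 < d)%N.
Proof.
case/andP=> /nonincreasingP fN /forallP fd.
apply/andP/idP => [[_ /forallP/(_ ord0)]|f0]; first by rewrite ffunE eqxx addn1.
split; last first.
  by apply/forallP => k; rewrite ffunE; case: eqP => [->|_]; rewrite ?addn1 ?addn0.
apply/nonincreasingP => k l kl; have := fN _ _ kl; rewrite !ffunE.
case: (eqVneq l ord0) => [l0|]; last by lia.
by move: kl; rewrite l0 leqn0 => /eqP k0; rewrite -val_eqE /= k0; lia.
Qed.

(** Here [lift ord0 k] is row k + 1 and [widen_ord _ k] is row k. The criterion is the same as in
    [removable_widen], which is what pairs the terms in [quad_sum]. *)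
Lemma addable_lift n d (f : {ffun 'I_n.+1 -> nat}) (k : 'I_n) : in_box d f ->
  addable d f (lift ord0 k) = (f (lift ord0 k) < f (widen_ord (leqnSn n) k))%N.
Proof.
case/andP=> /nonincreasingP fN /forallP fd.
apply/andP/idP => [[/nonincreasingP/(_ (widen_ord (leqnSn n) k) (lift ord0 k))]|lt_f].
  by rewrite !ffunE -!val_eqE /= /bump /= !add1n eqxx leqnSn; lia.
split; last first.
  apply/forallP => l; rewrite ffunE; case: eqP => [->|_]; last by rewrite addn0.
  by rewrite addn1 (leq_trans lt_f).
apply/nonincreasingP => i j ij; have := fN _ _ ij; rewrite !ffunE.
case: (eqVneq j (lift ord0 k)) => [jk|]; last by lia.
case: (eqVneq i (lift ord0 k)) => [|ik]; first by lia.
move=> _; rewrite addn0 addn1 jk (leq_trans lt_f) // fN //=.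
by move: ij ik; rewrite jk -!val_eqE /= /bump /=; lia.
Qed.

Lemma removable_max n d (f : {ffun 'I_n.+1 -> nat}) : in_box d f ->
  removable d f ord_max = (0 < f ord_max)%N.
Proof.
case/andP=> /nonincreasingP fN /forallP fd.
rewrite /removable; case: posnP => //= f0; apply/andP; split; last first.
  by apply/forallP => k; rewrite ffunE (leq_trans (leq_subr _ _)).
apply/nonincreasingP => k l kl; have := fN _ _ kl; rewrite !ffunE.
case: (eqVneq k ord_max) => [km|]; last by lia.
have -> : l = ord_max by apply: val_inj; move: kl (ltn_ord l); rewrite km /=; lia.
by rewrite km eqxx.
Qed.

Lemma removable_widen n d (f : {ffun 'I_n.+1 -> nat}) (k : 'I_n) : in_box d f ->
  removable d f (widen_ord (leqnSn n) k)
    = (f (lift ord0 k) < f (widen_ord (leqnSn n) k))%N.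
Proof.
case/andP=> /nonincreasingP fN /forallP fd.
apply/andP/idP => [[f0 /andP[/nonincreasingP/(_ (widen_ord (leqnSn n) k) (lift ord0 k))]]|lt_f].
  by rewrite !ffunE -!val_eqE /= /bump /= !add1n eqxx leqnSn; lia.
split; first by lia.
apply/andP; split; last first.
  by apply/forallP => l; rewrite ffunE (leq_trans (leq_subr _ _)).
apply/nonincreasingP => i j ij; have := fN _ _ ij; rewrite !ffunE.
case: (eqVneq i (widen_ord _ k)) => [ik|]; last by lia.
case: (eqVneq j (widen_ord _ k)) => [|jk]; first by lia.
move=> _; rewrite subn0 ik.
suff : (f j <= f (lift ord0 k))%N by lia.
by apply: fN; move: ij jk; rewrite ik -!val_eqE /= /bump /=; lia.
Qed.

(** The numbers n - 2i for i = 0, ..., n add up to zero. This evaluates the part of the diagonal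
    coefficient that does not depend on the diagram. *)
Lemma sum_centered (n : nat) (x : rat) :
  \sum_(i < n.+1) (n%:R - 2 * i%:R - x) = - (n.+1%:R * x).
Proof.
elim: n => [|m IH]; first by rewrite big_ord1 /=; ring.
rewrite big_ord_recr /=.
rewrite (eq_bigr (fun i : 'I_m.+1 => (m%:R - 2 * i%:R - x) + 1)); last first.
  by move=> i _; rewrite -natr1; ring.
rewrite big_split /= IH sumr_const card_ord -!natr1; ring.
Qed.

Lemma quad_sum n d (f : {ffun 'I_n -> nat}) : (0 < n)%N -> in_box d f ->
  \sum_i ((if addable d f i then quad n d (shifted f i) else 0)
       - (if removable d f i then quad n d (shifted f i - 1) else 0))
  = (2 * \sum_i f i)%:R - (n * d)%:R.
Proof.
case: n f => // n f _ fB.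
transitivity (\sum_i (quad n.+1 d (shifted f i) - quad n.+1 d (shifted f i - 1))).
  (* The terms left out of the full sums are collected by [miss]; it remains to see that they
     balance. *)
  pose miss (b : bool) (x : rat) := if b then 0 else quad n.+1 d x.
  have missE b x : (if b then quad n.+1 d x else 0) = quad n.+1 d x - miss b x.
    by rewrite /miss; case: b; rewrite ?subr0 ?subrr.
  under eq_bigr do rewrite !missE.
  rewrite !sumrB; set S1 := \sum_(i < _) miss _ _; set S2 := \sum_(i < _) miss _ _.
  suff -> : S1 = S2 by ring.
  (* Row k + 1 in [S1] is matched with row k in [S2], and row 0 in [S1] with the last row in
     [S2]. *)
  rewrite /S1 /S2 big_ord_recl big_ord_recr /= addrC; congr (_ + _); last first.
    apply: eq_bigr => k _; rewrite addable_lift // removable_widen // /miss.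
    case: ltnP => // le_f; congr quad; rewrite /shifted.
    have [/nonincreasingP fN _] := andP fB.
    have -> : f (widen_ord (leqnSn n) k) = f (lift ord0 k).
      by apply/eqP; rewrite eqn_leq le_f fN //= /bump /=; lia.
    by rewrite /= /bump /= natrD; ring.
  (* At the ends, a full row 0 gives F(d) = 0 and an empty last row gives F(-(n + 1)) = 0, as there
     are n + 1 rows here. *)
  rewrite addable0 // removable_max // /miss /shifted.
  have [_ /forallP/(_ ord0) f0d] := andP fB.
  case: ltnP => f0; case: posnP => fm //.
  - by rewrite fm /quad /= -natr1; ring.
  - have -> : f ord0 = d by lia.
    by rewrite fm /quad /= -natr1; ring.
  - have -> : f ord0 = d by lia.
    by rewrite /quad /=; ring.
have -> : \sum_i (quad n.+1 d (shifted f i) - quad n.+1 d (shifted f i - 1))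
   = \sum_(i < n.+1) (2 * (f i)%:R + (n%:R - 2 * i%:R - d%:R)).
  by apply: eq_bigr => i _; rewrite /quad /shifted -natr1; ring.
rewrite big_split /= -mulr_sumr natrM natr_sum; congr (_ + _).
by rewrite sum_centered natrM.
Qed.

Lemma op_raise_lower n d : (0 < n)%N ->
  (op (@raise n d) \o op (@lower n d))%VF - (op (@lower n d) \o op (@raise n d))%VF
  = op (@weight n d).
Proof.
move=> n0; apply: endo_box_ext => lam.
rewrite !(comp_lfunE, scale_lfunE, opp_lfunE, add_lfunE) !op_box.
by rewrite commutator_diag ?in_box_rows // quad_sum ?in_box_rows.
Qed.

(** * A representation from three operators *)

Lemma coord_ext (V : vectType rat) (u v : V) :
  (forall k, coord (vbasis fullv) k u = coord (vbasis fullv) k v) -> u = v.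
Proof.
move=> uv; rewrite (coord_vbasis (memvf u)) (coord_vbasis (memvf v)).
by apply: eq_bigr => k _; rewrite uv.
Qed.

Section Representation.
Context (V : vectType rat) (Em H Ep : 'End(V)).

Definition sl2_map (x : sl2) : 'End(V) :=
  x 0 (inord 0) *: Em + x 0 (inord 1) *: H + x 0 (inord 2) *: Ep.

Lemma sl2_map_linear : linear sl2_map.
Proof.
move=> a x y; rewrite /sl2_map !mxE !scalerDl !scalerDr !scalerA.
by rewrite [RHS]addrACA; congr (_ + _); rewrite addrACA.
Qed.
HB.instance Definition _ :=
  GRing.isLinear.Build rat sl2 'End(V) _ sl2_map sl2_map_linear.

Lemma sl2_map_gen :
  (sl2_map sl2_em = Em) * (sl2_map sl2_h = H) * (sl2_map sl2_ep = Ep).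
Proof.
by rewrite /sl2_map !mxE !eqxx !sl2_coord_neq /= !scale0r !scale1r !add0r !addr0.
Qed.

Lemma sl2_linfun_gen : (linfun sl2_map sl2_em = Em) *
  (linfun sl2_map sl2_h = H) * (linfun sl2_map sl2_ep = Ep).
Proof. by rewrite !lfunE /= !sl2_map_gen. Qed.

(** By bilinearity the commutators of the basis elements suffice. *)
Lemma sl2_map_representation :
  (H \o Ep)%VF - (Ep \o H)%VF = 2 *: Ep ->
  (H \o Em)%VF - (Em \o H)%VF = - 2 *: Em ->
  (Ep \o Em)%VF - (Em \o Ep)%VF = H ->
  is_sl2_representation (linfun sl2_map).
Proof.
move=> HEp HEm EpEm x y; rewrite !lfunE /sl2_bracket !linearD !linearZ /=.
rewrite !sl2_map_gen /sl2_map.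
rewrite !(comp_lfunDl, comp_lfunDr) -!comp_lfunZl -!comp_lfunZr.
(* Read as rewriting rules, the relations bring each product of two distinct operators into the
   order [Em], [Ep], [H]. *)
move: HEp HEm EpEm => /(canRL (subrK _)) -> /(canRL (subrK _)) -> .
move=> /(canRL (subrK _)) ->.
apply/lfunP => v; rewrite !(comp_lfunE, scale_lfunE, opp_lfunE, add_lfunE).
(* In coordinates the identity is one between rational numbers, within reach of [ring]. *)
apply: coord_ext => k; set phi := coord _ k.
have phiD u w : phi (u + w) = phi u + phi w := raddfD phi u w.
have phiN u : phi (- u) = - phi u := raddfN phi u.
have phiZ c u : phi (c *: u) = c * phi u := linearZ_LR phi c u.
by rewrite !(phiD, phiN, phiZ); ring.
Qed.

End Representation.

(** * The Pieri rule *)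

Lemma card_ord_interval N a b : (b <= N)%N ->
  #|[set j : 'I_N | (a <= j < b)%N]| = (b - a)%N.
Proof.
move=> bN; rewrite cardsE -sum1_card -[RHS]muln1 -sum_nat_const_nat.
rewrite (big_nat_widenl a 0%N) // (big_nat_widen 0%N b N) // big_mkord.
by apply: eq_bigl => j; rewrite -topredE.
Qed.

Section SkewCells.
Context (n : nat) (lam nu : diagram n).
Implicit Types c : skew_cell lam nu.

Lemma skew_cellP c : (lam (val c).1 <= cell_col c < nu (val c).1)%N.
Proof. exact: valP c. Qed.

Lemma skew_cell_exists (i : 'I_n) (j : nat) : (lam i <= j < nu i)%N ->
  exists c, (val c).1 = i /\ cell_col c = j.
Proof.
move=> /andP[lj ju].
(* Columns are indexed below [ncells nu], which bounds the length of every row. *)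
have jN : (j < ncells nu)%N.
  by rewrite (leq_trans ju) // /ncells (bigD1 i) //= leq_addr.
have H : (lam (i, Ordinal jN).1 <= (i, Ordinal jN).2 < nu (i, Ordinal jN).1)%N.
  by rewrite /= lj ju.
by exists (exist _ (i, Ordinal jN) H).
Qed.

Lemma skew_cell_inj c c' :
  cell_row c = cell_row c' -> cell_col c = cell_col c' -> c = c'.
Proof.
move=> /val_inj eq_row /val_inj eq_col; apply: val_inj.
by case: c c' eq_row eq_col => [[? ?] ?] [[? ?] ?] /= -> ->.
Qed.

Lemma cell_row_lt c : (cell_row c < n)%N.
Proof. exact: ltn_ord. Qed.

End SkewCells.

Lemma diagram_noninc n (nu : diagram n) (i j : 'I_n) :
  (i <= j)%N -> (nu j <= nu i)%N.
Proof. by move/nonincreasingP: (rows_noninc nu); apply. Qed.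

Lemma single_rowE n k (i : 'I_n) :
  single_row n k i = (if i == 0%N :> nat then k else 0)%N.
Proof. by rewrite /row_len /= ffunE. Qed.

Section Pieri.
Context (n : nat) (n_gt0 : (0 < n)%N) (nu : diagram n).
Local Notation cell := (skew_cell (single_row n 1) nu).
Implicit Types (c : cell) (T : {ffun cell -> 'I_n}) (r : 'I_n).

Lemma cell_col_gt0 c : cell_row c = 0%N -> (0 < cell_col c)%N.
Proof.
by move=> c0; have := skew_cellP c; rewrite single_rowE [nat_of_ord _]c0 => /andP[].
Qed.

Lemma cell_col_lt c (i : 'I_n) : (i <= cell_row c)%N -> (cell_col c < nu i)%N.
Proof.
move=> /diagram_noninc le_nu; have /andP[_ lt_c] := skew_cellP c.
exact: leq_trans lt_c (le_nu nu).
Qed.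

(** The shape lacks only the corner of [nu]; the condition [i == 0%N <= j], with the boolean read as
    a number, excludes just that cell. *)
Lemma cell_exists (i j : nat) (lt_in : (i < n)%N) :
  (j < nu (Ordinal lt_in))%N -> (i == 0%N <= j)%N ->
  exists c, cell_row c = i /\ cell_col c = j.
Proof.
move=> lt_j le_j; have [|c [c1 c2]] := @skew_cell_exists n (single_row n 1) nu (Ordinal lt_in) j.
  by rewrite lt_j single_rowE /= andbT; case: (i) le_j.
by exists c; rewrite /cell_row c1.
Qed.

Lemma cell_above c i : (i <= cell_row c)%N -> (i == 0%N <= cell_col c)%N ->
  exists d : cell, cell_row d = i /\ cell_col d = cell_col c.
Proof.
move=> le_i; have lt_in := leq_ltn_trans le_i (cell_row_lt c).
by apply: (@cell_exists _ _ lt_in); apply: cell_col_lt.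
Qed.

Definition ord_pred_trunc (i : 'I_n) : 'I_n :=
  Ordinal (leq_ltn_trans (leq_pred i) (ltn_ord i)).

(* Let row [i] contain only [i]'s, except that in column 0 the entries of rows
   [1, ..., r] are lowered by one, the removed corner cell being pushed down to
   row [r]; the weight is then [nu] minus a cell in row [r]. *)
Definition pieri_tableau r : {ffun cell -> 'I_n} :=
  [ffun c => if (cell_col c == 0%N) && (cell_row c <= r)%N
             then ord_pred_trunc (val c).1 else (val c).1].

Lemma pieri_tableauE r c : pieri_tableau r c =
  (cell_row c - ((cell_col c == 0%N) && (cell_row c <= r)))%N :> nat.
Proof. by rewrite ffunE; case: ifP => _; rewrite ?subn1 ?subn0. Qed.

(** Lowering the upper part of column 0 keeps it strictly increasing and only decreases first
    entries of rows. Truncation at 0 never occurs, since the corner is missing. *)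
Lemma pieri_semistandard r : semistandard (pieri_tableau r).
Proof.
apply/forallP => c; apply/forallP => c'; rewrite !pieri_tableauE.
have c0 := @cell_col_gt0 c; have c'0 := @cell_col_gt0 c'.
by apply/andP; split; apply/implyP => /andP[]; lia.
Qed.

(** The letter v occurs at most once in a column, and it occurs in the columns before [nu v], except
    column 0 when v = r. So cells are counted by their columns. *)
Lemma pieri_weight r (v : 'I_n) : (0 < nu r)%N ->
  #|[set c | pieri_tableau r c == v]| = (nu v - (v == r))%N.
Proof.
move=> nu_r; rewrite -(@card_ord_interval (ncells nu)); last first.
  by rewrite /ncells (bigD1 v) //= leq_addr.
rewrite -(@card_in_imset _ _ (fun c : cell => (val c).2)).
  apply: eq_card => j; rewrite !inE; apply/imsetP/idP.
    case=> c; rewrite inE -val_eqE /= pieri_tableauE => cv ->.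
    have := @cell_col_gt0 c; have := @cell_col_lt c v; rewrite -[v == r]val_eqE /=.
    rewrite -/(cell_col c) => lt0 gt0.
    have vle : (v <= cell_row c)%N by move: cv; clear; lia.
    by rewrite (lt0 vle) andbT; move: cv gt0; clear; lia.
  move=> jv.
  have jv1 : (j < nu v)%N by case/andP: jv.
  (* The letter v stands in row v, or in row v + 1 within the lowered part of column 0. *)
  have [c [c1 c2]] : exists c,
      cell_row c = (v + ((j == 0%N :> nat) && (v < r)))%N /\ cell_col c = j.
    case: (boolP ((j == 0%N :> nat) && (v < r)%N)) => [/andP[/eqP j0 vr]|jvr] /=.
      have lt_n : (v + 1 < n)%N by apply: leq_ltn_trans (ltn_ord r); rewrite addn1.
      apply: (@cell_exists _ _ lt_n); last by rewrite addn1.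
      by rewrite j0 (leq_trans nu_r) // diagram_noninc //= addn1.
    have lt_n : (v + 0 < n)%N by rewrite addn0.
    apply: (@cell_exists _ _ lt_n).
      by rewrite (leq_trans jv1) // diagram_noninc //= addn0.
    move: jv jvr; rewrite -[v == r]val_eqE /=; have := n_gt0; lia.
  exists c; last by apply: val_inj.
  rewrite inE -val_eqE /= pieri_tableauE c1 c2.
  by move: jv; rewrite -[v == r]val_eqE /=; clear; lia.
move=> c c'; rewrite !inE -!val_eqE /= !pieri_tableauE => cv c'v /(congr1 val) /= cc.
have {}cc : cell_col c = cell_col c' by [].
apply: skew_cell_inj => //; move: (@cell_col_gt0 c) (@cell_col_gt0 c') cv c'v.
by rewrite cc; clear; lia.
Qed.

Lemma pieri_lattice r :
  (forall v : 'I_n, v = r.+1 :> nat -> (nu v < nu r)%N) ->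
  lattice_word (pieri_tableau r).
Proof.
move=> nu_r; apply/forallP => c'; apply/forallP => u; apply/forallP => v.
apply/implyP => /eqP vu.
(* Sends each letter [u + 1] to an earlier letter [u], injectively: move up one
   row, and also one column to the right when leaving row [r + 1]. *)
pose shift c := odflt c
  [pick d : cell | (cell_row d == (cell_row c).-1) &&
                   (cell_col d == cell_col c + (cell_row c == r.+1))%N].
have shiftE c : pieri_tableau r c = v ->
    cell_row (shift c) = (cell_row c).-1 /\
    cell_col (shift c) = (cell_col c + (cell_row c == r.+1))%N.
  move=> /(congr1 val) /=; rewrite pieri_tableauE vu => cv.
  rewrite /shift; case: pickP => [d /andP[/eqP-> /eqP->] //|none].
  have lt_n : ((cell_row c).-1 < n)%N by apply: leq_ltn_trans (cell_row_lt c); lia.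
  have [||d [d1 d2]] := @cell_exists (cell_row c).-1 (cell_col c + (cell_row c == r.+1))%N lt_n.
  - case: eqP => [cr|_].
      (* The strict inequality lets row r reach a column further than row r + 1, so the cell shifted
         to exists. *)
      have -> : Ordinal lt_n = r by apply: val_inj; rewrite /= cr.
      rewrite addn1; apply: leq_ltn_trans (nu_r (val c).1 cr).
      exact: (cell_col_lt (i := (val c).1)).
    by rewrite addn0; apply: cell_col_lt => /=; lia.
  - have := @cell_col_gt0 c; move: cv; lia.
  by have := none d; rewrite d1 d2 !eqxx.
rewrite -(@card_in_imset _ _ shift).
  apply/subset_leq_card/subsetP => _ /imsetP[c + ->].
  rewrite !inE => /andP[up /eqP cv]; have [s1 s2] := shiftE _ cv.
  move/(congr1 val): cv; rewrite /= pieri_tableauE vu => cv.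
  rewrite -val_eqE /= pieri_tableauE /read_upto s1 s2.
  have := @cell_col_gt0 c; move: cv up; rewrite /read_upto; lia.
move=> c d; rewrite !inE => /andP[_ /eqP cv] /andP[_ /eqP dv] eq_s.
have [c1 c2] := shiftE _ cv; have [d1 d2] := shiftE _ dv.
move/(congr1 val): cv; move/(congr1 val): dv; rewrite /= !pieri_tableauE vu => cv dv.
have e1 : (cell_row c).-1 = (cell_row d).-1 by rewrite -c1 -d1 eq_s.
have e2 : (cell_col c + (cell_row c == r.+1) = cell_col d + (cell_row d == r.+1))%N.
  by rewrite -c2 -d2 eq_s.
have e3 : cell_row c = cell_row d by move: cv dv e1; lia.
by apply: skew_cell_inj => //; move: e2; rewrite e3; apply: addIn.
Qed.

(** * Every Littlewood-Richardson tableau of this shape is a [pieri_tableau] *)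

Section Uniqueness.
Context (T : {ffun cell -> 'I_n}).
Hypotheses (T_ss : semistandard T) (T_lat : lattice_word T).

Lemma row_le c c' : cell_row c = cell_row c' -> (cell_col c <= cell_col c')%N ->
  (T c <= T c')%N.
Proof.
move=> e le; have /forallP/(_ c)/forallP/(_ c')/andP[/implyP H _] := T_ss.
by apply: H; rewrite e eqxx.
Qed.

Lemma col_lt c c' : cell_col c = cell_col c' -> (cell_row c < cell_row c')%N ->
  (T c < T c')%N.
Proof.
move=> e lt; have /forallP/(_ c)/forallP/(_ c')/andP[_ /implyP H] := T_ss.
by apply: H; rewrite e eqxx.
Qed.

(* A letter [v > 0] in row [i] is preceded in the reading word by a letter
   [v - 1], which cannot lie in row [i] since rows increase. *)
Lemma entry_le_row c : (T c <= cell_row c)%N.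
Proof.
have [k] := ubnP (cell_row c); elim: k c => // k IH c; rewrite ltnS => ck.
rewrite leqNgt; apply/negP => lt_T.
have T_gt0 : (0 < T c)%N by apply: leq_trans lt_T.
have /forallP/(_ c)/forallP/(_ (ord_pred_trunc (T c)))/forallP/(_ (T c)) := T_lat.
rewrite /= prednK // eqxx /= => le_card.
have : (0 < #|[set d | read_upto c d && (T d == ord_pred_trunc (T c))]|)%N.
  apply: leq_trans le_card; apply/card_gt0P; exists c.
  by rewrite inE eqxx andbT /read_upto eqxx leqnn orbT.
case/card_gt0P => d; rewrite inE -val_eqE /= => /andP[up /eqP Td].
case/orP: up => [lt_r|/andP[/eqP e le_c]].
  by have := IH d (leq_trans lt_r ck); lia.
by have := row_le (esym e) le_c; lia.
Qed.

(** The cells between [c] and [c'] all belong to the shape, and each row down raises the entry by at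
    least one. *)
Lemma col_growth c c' : cell_col c = cell_col c' -> (cell_row c <= cell_row c')%N ->
  (T c + (cell_row c' - cell_row c) <= T c')%N.
Proof.
move=> e le.
have [m def_m] : exists m, m = (cell_row c' - cell_row c)%N by exists (cell_row c' - cell_row c)%N.
rewrite -def_m; elim: m c' e le def_m => [|m IH] c' e le def_m.
  have -> : c = c' by apply: skew_cell_inj => //; lia.
  by rewrite addn0.
have [||d [d1 d2]] := @cell_above c' (cell_row c').-1; first by lia.
  by have := @cell_col_gt0 c; lia.
have := IH d; rewrite d1 d2 => /(_ e) IHd.
have := @col_lt d c' d2; rewrite d1; lia.
Qed.

(** Away from column 0 a column starts in row 0, so its growth matches the upper bound
    [entry_le_row]. *)
Lemma entry_eq_row c : (0 < cell_col c)%N -> T c = cell_row c :> nat.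
Proof.
move=> c_gt0; apply/eqP; rewrite eqn_leq entry_le_row /=.
have [||d [d1 d2]] := @cell_above c 0%N => //.
by have := col_growth d2; rewrite d1; lia.
Qed.

(** Column 0 starts only in row 1, which weakens the bound by one. *)
Lemma entry_ge_pred_row c : ((cell_row c).-1 <= T c)%N.
Proof.
case: (posnP (cell_col c)) => [c0|/entry_eq_row->]; last exact: leq_pred.
case: (posnP (cell_row c)) => [-> //|cr].
have [||d [d1 d2]] := @cell_above c 1%N => //.
by have := col_growth d2; rewrite d1; lia.
Qed.

(** Entries smaller than their row index lie in column 0, and by [col_growth] all cells above such
    an entry share this property. The last row where it happens is r. *)
Lemma lattice_tableauP : (forall i : 'I_n, (single_row n 1 i <= nu i)%N) ->
  exists2 r, (0 < nu r)%N & T = pieri_tableau r.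
Proof.
move=> nu0; pose B := [pred c | (cell_col c == 0%N) && (T c < cell_row c)%N].
case: (pickP B) => [c0 Bc0|B0].
  case: (arg_maxnP (fun c => cell_row c) Bc0) => cm /andP[/eqP cm0 lt_cm] max_cm.
  exists (val cm).1; first by have := cell_col_lt (leqnn _ : ((val cm).1 <= cell_row cm)%N); lia.
  apply/ffunP => c; apply: ord_inj; rewrite /= pieri_tableauE -/(cell_row cm).
  have := entry_le_row c; have := entry_ge_pred_row c; have := @entry_eq_row c.
  case: (posnP (cell_col c)) => [c_0|_ /(_ isT) -> _ _]; last by rewrite subn0.
  move=> _ ge le /=; case: leqP => lt_c.
    have := @col_growth c cm; rewrite c_0 cm0 => /(_ erefl lt_c).
    lia.
  have := max_cm c; rewrite /B /= c_0 /=; lia.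
(* No entry is lowered, which is the case r = 0 because the corner is absent. *)
exists (Ordinal n_gt0); first by have := nu0 (Ordinal n_gt0); rewrite single_rowE.
apply/ffunP => c; apply: ord_inj; rewrite /= pieri_tableauE /=.
have := entry_le_row c; have := @cell_col_gt0 c; have := @entry_eq_row c.
have := B0 c; rewrite /=; lia.
Qed.

End Uniqueness.

(** The tableaux counted are [pieri_tableau r] of weight [lam], and the weight determines r, so
    there is at most one. *)
Lemma LR_coef_single_row (lam : diagram n) :
  LR_coef (single_row n 1) lam nu = [exists r, rows nu == incr_row (rows lam) r] :> nat.
Proof.
have weightP r : (0 < nu r)%N ->
    has_weight lam (pieri_tableau r) = (rows nu == incr_row (rows lam) r).
  move=> nu_r; apply/forallP/eqP => [wt|eq_nu v].
    apply/ffunP => k; have := eqP (wt k); rewrite pieri_weight // ffunE.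
    rewrite /row_len; case: (eqVneq k r) => [->|_]; last by rewrite subn0 addn0.
    by move=> <-; rewrite subnK.
  by rewrite pieri_weight // /row_len eq_nu ffunE addnK.
rewrite /LR_coef; case: forallP => [nu0|nu0]; last first.
  (* Here [nu] is empty, whereas [lam] with a cell added is not. *)
  case: existsP => // -[r /eqP eq_nu]; case: nu0 => i; rewrite single_rowE.
  case: eqP => // i0.
  have : (0 < nu r)%N by rewrite /row_len eq_nu ffunE eqxx addn1.
  by move=> nu_r; apply: leq_trans nu_r (diagram_noninc _ _); rewrite i0.
case: existsP => [[r /eqP eq_nu]|none]; last first.
  apply/eqP; rewrite cards_eq0 -subset0; apply/subsetP => T.
  rewrite !inE => /and3P[ss wt lat]; have [r nu_r eqT] := lattice_tableauP ss lat nu0.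
  by case: none; exists r; rewrite -weightP // -eqT.
apply/eqP/cards1P; exists (pieri_tableau r); apply/setP => T; rewrite !inE.
have nu_r : (0 < nu r)%N by rewrite /row_len eq_nu ffunE eqxx addn1.
apply/and3P/eqP => [[ss wt lat]|->].
  have [s nu_s eqT] := lattice_tableauP ss lat nu0.
  have := weightP _ nu_s; rewrite -eqT wt => /esym/eqP.
  rewrite eq_nu eqT => /ffunP/(_ r); rewrite !ffunE eqxx => /addnI.
  by case: (eqVneq r s) => [->|].
split; [exact: pieri_semistandard | by rewrite weightP // eq_nu|].
(* Row r + 1 is the same in [lam] and [nu], while row r of [nu] is longer by one. *)
apply: pieri_lattice => v vr; rewrite /row_len eq_nu !ffunE eqxx.
rewrite -val_eqE /= vr; have -> : (r.+1 == r)%N = false by lia.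
rewrite addn0 addn1 ltnS.
by have := @diagram_noninc _ lam r v; rewrite vr leqnSn; apply.
Qed.

End Pieri.

(** * The operators of the statement *)

Lemma QYbox_incl_linear n d : linear (@QYbox_incl n d).
Proof.
move=> a u v; rewrite /QYbox_incl scaler_sumr -big_split /=.
by apply: eq_bigr => lam _; rewrite !ffunE scalerDl scalerA.
Qed.
HB.instance Definition _ n d :=
  GRing.isLinear.Build rat (QYbox n d) (QY n) _ (@QYbox_incl n d) (@QYbox_incl_linear n d).

(** With rows bounded by d, [rvec] is zero only if [f] is not a diagram at all, and then [insub]
    fails too. *)
Lemma QYbox_incl_rvec n d (f : {ffun 'I_n -> nat}) : (forall i, f i <= d)%N ->
  QYbox_incl (rvec d f) = dvec_opt (insub f).
Proof.
move=> fd; rewrite /QYbox_incl; case: insubP => [mu fN eq_mu|fN] /=.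
  have /in_boxP[lam eq_f] : in_box d f by rewrite /in_box fN; apply/forallP.
  rewrite (bigD1 lam) //= ffunE eq_f eqxx scale1r big1 ?addr0 => [|nu nu_lam].
    by congr dvec; apply: val_inj; rewrite /= eq_mu -eq_f.
  rewrite ffunE -eq_f (inj_eq (@box_rows_nat_inj n d)) (negPf nu_lam).
  exact: scale0r.
rewrite big1 // => nu _; rewrite ffunE; case: eqP => [eq_f|_]; last exact: scale0r.
by rewrite -eq_f rows_noninc in fN.
Qed.

Lemma LR_prod_single_row n (lam : diagram n) : (0 < n)%N ->
  LR_prod (single_row n 1) lam = \sum_i dvec_opt (add_cell lam i).
Proof.
move=> n_gt0; rewrite /LR_prod; set N := (_ + _)%N.
have ncells1 : ncells (single_row n 1) = 1%N.
  rewrite /ncells (bigD1 (Ordinal n_gt0)) //= single_rowE /= big1 // => i.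
  by rewrite single_rowE -val_eqE /= => /negPf->.
have lamN i : (lam i < N)%N.
  by rewrite /N ncells1 add1n ltnS /ncells (bigD1 i) //= leq_addr.
(* As N = |lam| + 1 exceeds every row of [lam], the box with N columns cuts off no term. *)
transitivity (\sum_(i < n) QYbox_incl (rvec N (incr_row (rows lam) i))); last first.
  apply: eq_bigr => i _; apply: QYbox_incl_rvec => k; rewrite ffunE.
  by case: eqP => _; rewrite ?addn1 ?addn0; [apply: lamN|apply: ltnW (lamN k)].
rewrite /QYbox_incl exchange_big /=; apply: eq_bigr => nu _.
rewrite -scaler_suml.
suff -> : (LR_coef (single_row n 1) lam nu)%:R
    = \sum_(i < n) rvec N (incr_row (rows lam) i) nu by [].
rewrite LR_coef_single_row //; under eq_bigr do rewrite ffunE.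
case: existsP => [[r /eqP eq_nu]|none]; last first.
  by rewrite big1 // => i _; case: eqP => // eq_nu; case: none; exists i; apply/eqP.
rewrite (bigD1 r) //= /box_rows_nat eq_nu eqxx big1 ?addr0 // => i ir.
case: eqP => // /ffunP/(_ i); rewrite !ffunE eqxx (negPf ir).
by move/addnI.
Qed.

Lemma QYbox_incl_lower n d (lam : box_diagram n d) :
  QYbox_incl (lower d (box_rows_nat lam)) = Dtilde_minus lam.
Proof.
rewrite /Dtilde_minus /xi_minus /nabla_minus scaler_sumr -big_split /= -sumrN.
rewrite linear_sum; apply: eq_bigr => i _; rewrite linearZ /= -scalerDl -scaleNr.
congr (_ *: _); rewrite /remove_cell; case: ifP => lam_gt0; last first.
  exact: linear0.
apply: QYbox_incl_rvec => k.
by rewrite !ffunE (leq_trans (leq_subr _ _)) // -ltnS.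
Qed.

Lemma QYbox_incl_weight n d (lam : box_diagram n d) :
  QYbox_incl (weight d (box_rows_nat lam)) = Dtilde_zero d lam.
Proof.
rewrite linearZ /= QYbox_incl_rvec => [|k]; last by rewrite ffunE -ltnS.
congr (_ *: _); case: insubP => [mu _ eq_mu|] /=.
  by congr dvec; apply: val_inj.
by rewrite rows_noninc.
Qed.

(** Only a cell added to a full row can leave the box. In row 0 its coefficient is d - d = 0; in
    another row the result is no diagram, as row 0 has length at most d. *)
Lemma QYbox_incl_raise n d (lam : box_diagram n d) : (0 < n)%N ->
  QYbox_incl (raise d (box_rows_nat lam)) = Dtilde_plus d lam.
Proof.
move=> n_gt0; rewrite /Dtilde_plus LR_prod_single_row // scaler_sumr -sumrB.
rewrite linear_sum; apply: eq_bigr => i _; rewrite linearZ /= -scalerBl.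
have lamd k : (lam k <= d)%N by rewrite /row_len ffunE -ltnS.
case: (ltnP (lam i) d) => [lam_lt|lam_ge].
  congr (_ *: _); apply: QYbox_incl_rvec => k; rewrite ffunE.
  by case: eqP => [->|_]; rewrite ?addn1 ?addn0 //; apply: lamd.
have lami : lam i = d by apply/eqP; rewrite eqn_leq lamd.
case: (posnP i) => [i0|i_gt0].
  rewrite /upc [box_rows_nat lam i]lami lami /content i0 subr0.
  by rewrite -pmulrn subrr !scale0r.
have not_box : ~~ nonincreasing (incr_row (rows lam) i).
  apply/negP => /nonincreasingP/(_ (Ordinal n_gt0) i (leq0n _)).
  rewrite !ffunE eqxx -val_eqE /= eq_sym (gtn_eqF i_gt0) addn0 addn1 => lt_f.
  have := lamd (Ordinal n_gt0); have := lam_ge; rewrite /row_len !ffunE => ge le.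
  by have := leq_trans lt_f (leq_trans le ge); rewrite ltnn.
rewrite rvec_eq0 ?linear0 ?scaler0 => [|]; last first.
  by rewrite /in_box negb_and not_box.
by rewrite /add_cell insubF ?scaler0 //; apply/negbTE.
Qed.

Theorem theorem8 (n d : nat) (hn : (1 <= n)%N) (hd : (1 <= d)%N) :
  exists rho : 'Hom(sl2, 'End(QYbox n d)),
    is_sl2_representation rho
    /\ forall lam : box_diagram n d,
         [/\ QYbox_incl (rho sl2_em (box_vec lam)) = Dtilde_minus lam,
             QYbox_incl (rho sl2_h (box_vec lam)) = Dtilde_zero d lam
           & QYbox_incl (rho sl2_ep (box_vec lam)) = Dtilde_plus d lam].
Proof.
exists (linfun (sl2_map (op (@lower n d)) (op (@weight n d)) (op (@raise n d)))).
split.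
  apply: sl2_map_representation; first exact: op_weight_raise.
    exact: op_weight_lower.
  exact: op_raise_lower.
move=> lam; rewrite !sl2_linfun_gen !op_box.
by rewrite QYbox_incl_lower QYbox_incl_weight QYbox_incl_raise.
Qed.
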